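(* Let $\Omega\subseteq\mathbb{R}^n$ be open, $u:\Omega\to\mathbb{R}^N$ continuous, $x\in\Omega$ and $\xi\in\mathbb{S}^{N-1}$. Let $D^{2,\xi}u(x)$ be the set of pairs $(D\psi(x),D^2\psi(x))$ where $\psi\in C^2(\mathbb{R}^n)^N$ ranges over maps with $\psi(x)=u(x)$ such that for every $L>0$ there is a neighbourhood of $x$ in $\Omega$ on which $|\xi^\perp(u-\psi)(y)|^2\le L^2|y-x|^2\,[-\xi^\top(u-\psi)(y)]$. Then $D^{2,\xi}u(x)=J^{2,\xi}u(x)$.
   Context: Notation: summation over repeated indices; $\mathbb{R}^N\otimes\mathbb{R}^{n\times n}_s$ is the space of arrays $\mathbf{X}=(\mathbf{X}_{\alpha ij})$ ($\alpha\le N$, $i,j\le n$) symmetric in $i,j$; $\mathbf{X}:z\otimes z\in\mathbb{R}^N$ has components $\mathbf{X}_{\alpha ij}z_iz_j$. For $a,b\in\mathbb{R}^N$, $a\vee b:=\frac12(a\otimes b+b\otimes a)$; matrix inequalities are in the sense of quadratic forms. For $\xi\in\mathbb{S}^{N-1}$, $\xi^\perp:=I-\xi\otimes\xi$ (orthogonal projection onto the hyperplane normal to $\xi$) and $\xi^\top v$ is the inner product. Second contact jet: $J^{2,\xi}u(x)$ is the set of $(P,\mathbf{X})\in\mathbb{R}^{N\times n}\times(\mathbb{R}^N\otimes\mathbb{R}^{n\times n}_s)$ such that there is a continuous $T:\mathbb{R}^n\setminus\{0\}\to\mathbb{R}^{N\times N}_s$ with $|T(y)|\to0$ as $y\to0$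 and $\xi\vee[u(z)-u(x)-P(z-x)-\frac12\mathbf{X}:(z-x)\otimes(z-x)]\le|z-x|^2T(z-x)$ for all $z\ne x$ near $x$. *)

(* Defs.v *)
From HB Require Import structures.
From mathcomp Require Import all_boot all_order all_algebra.
From mathcomp Require Import all_classical all_reals all_analysis.
Set Implicit Arguments. Unset Strict Implicit. Unset Printing Implicit Defensive.
Import Order.TTheory GRing.Theory Num.Theory.
Import numFieldNormedType.Exports.
Local Open Scope classical_set_scope.
Local Open Scope ring_scope.

Section Defs.
Variable R : realType.

Definition sqn k (v : 'rV[R]_k) : R := \sum_(i < k) v 0 i ^+ 2.
Definition dotv k (a b : 'rV[R]_k) : R := \sum_(i < k) a 0 i * b 0 i.
Definition projperp k (xi w : 'rV[R]_k) : 'rV[R]_k := w - dotv xi w *: xi.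
Definition vee k (a b : 'rV[R]_k) : 'M[R]_k := 2^-1 *: (a^T *m b + b^T *m a).
Definition qle k (A B : 'M[R]_k) : Prop :=
  forall v : 'rV[R]_k, (v *m A *m v^T) 0 0 <= (v *m B *m v^T) 0 0.
Definition symmx k (A : 'M[R]_k) : Prop := A^T = A.

Definition ebasis n (i : 'I_n) : 'rV[R]_n := delta_mx 0 i.
Definition partial n (i : 'I_n) (f : 'rV[R]_n -> R) : 'rV[R]_n -> R :=
  fun y => derive f y (ebasis i).

Definition C2 n (f : 'rV[R]_n -> R) : Prop :=
  continuous f /\
  (forall i y, derivable f y (ebasis i)) /\
  (forall i, continuous (partial i f)) /\
  (forall i j y, derivable (partial i f) y (ebasis j)) /\
  (forall i j, continuous (partial j (partial i f))).

Definition compo n N (a : 'I_N) (psi : 'rV[R]_n -> 'rV[R]_N) : 'rV[R]_n -> R :=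
  fun y => psi y 0 a.

Definition jetrem n N (u : 'rV[R]_n -> 'rV[R]_N) (x : 'rV[R]_n)
  (P : 'M[R]_(N, n)) (X : 'I_N -> 'M[R]_n) (z : 'rV[R]_n) : 'rV[R]_N :=
  let h := z - x in
  u z - u x - h *m P^T - 2^-1 *: \row_(a < N) (h *m X a *m h^T) 0 0.

Definition J2xi n N (u : 'rV[R]_n -> 'rV[R]_N) (x : 'rV[R]_n) (xi : 'rV[R]_N)
  : set ('M[R]_(N, n) * ('I_N -> 'M[R]_n)) :=
  [set PX | (forall a, symmx (PX.2 a)) /\
    exists T : 'rV[R]_n -> 'M[R]_N,
      {within [set y | y != 0], continuous T} /\
      (forall y, y != 0 -> symmx (T y)) /\
      (T y @[y --> (0 : 'rV[R]_n)^'] --> (0 : 'M[R]_N)) /\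
      \forall z \near x, z != x ->
         qle (vee xi (jetrem u x PX.1 PX.2 z)) (sqn (z - x) *: T (z - x))].

Definition D2xi n N (Omega : set 'rV[R]_n) (u : 'rV[R]_n -> 'rV[R]_N)
  (x : 'rV[R]_n) (xi : 'rV[R]_N) : set ('M[R]_(N, n) * ('I_N -> 'M[R]_n)) :=
  [set PX | exists psi : 'rV[R]_n -> 'rV[R]_N,
     (forall a, C2 (compo a psi)) /\ psi x = u x /\
     PX.1 = \matrix_(a < N, i < n) partial i (compo a psi) x /\
     PX.2 = (fun a => \matrix_(i < n, j < n) partial j (partial i (compo a psi)) x) /\
     forall L : R, 0 < L -> \forall y \near x, Omega y /\
       sqn (projperp xi (u y - psi y))
         <= L ^+ 2 * sqn (y - x) * (- dotv xi (u y - psi y))].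
End Defs.

(* Main.v *)
(** Both sets coincide with the pairs [(P, X)], [X] symmetric, whose second-order remainder [w]
    satisfies [|w| + xi . w <= e |z - x|^2] near [x] for every [e > 0]. For a unit vector [xi],
    [|w| + xi . w] is twice the largest eigenvalue of [vee xi w], which gives the
    equivalence with the jet inequality.
    If [v = u - psi] satisfies the inequality defining [D2xi], so that
    [|v|^2 <= (e - xi . v)^2] with [e] of order [L^2 |z - x|^2], then [|v| + xi . v <= e], and
    the Taylor remainder of [psi] only adds [o(|z - x|^2)].
    Conversely, the Taylor polynomial is corrected by [s(z) xi], where [s >= |w| + xi . w] near
    [x] is [C^2] with vanishing 2-jet at [x]: then [|xi^perp w|^2 <= 2 s (s - xi . w)].
    One takes [s(z) = 4 G(|z - x|^2)], where [G] is a primitive of [w1] with [w1(0) = 0] and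
    [t w1'(t) -> 0] as [t -> 0]; such a [w1] is the running average of a concave modulus. *)

Require Import Defs.
From HB Require Import structures.
From mathcomp Require Import all_boot all_order all_algebra.
From mathcomp Require Import all_classical all_reals all_analysis.
From mathcomp Require Import ring lra.
Set Implicit Arguments.
Unset Strict Implicit.
Unset Printing Implicit Defensive.
Import Order.TTheory GRing.Theory Num.Theory.
Import numFieldNormedType.Exports.
Local Open Scope classical_set_scope.
Local Open Scope ring_scope.

(** * Euclidean geometry of the contact inequality *)

Section Euclid.
Variables (R : realType) (k : nat).
Implicit Types (u v w xi : 'rV[R]_k) (a b e s t : R).

Lemma dotvC v w : dotv v w = dotv w v.
Proof. by apply: eq_bigr => i _; rewrite mulrC. Qed.

Lemma dotv_linr v a b u w :
  dotv v (a *: u + b *: w) = a * dotv v u + b * dotv v w.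
Proof.
rewrite /dotv !mulr_sumr -big_split; apply: eq_bigr => i _ /=; rewrite !mxE.
ring.
Qed.

Lemma dotvDr v u w : dotv v (u + w) = dotv v u + dotv v w.
Proof. by have := dotv_linr v 1 1 u w; rewrite !scale1r !mul1r. Qed.

Lemma dotv0r v : dotv v 0 = 0.
Proof. by rewrite /dotv big1// => i _; rewrite mxE mulr0. Qed.

Lemma sqnE v : sqn v = dotv v v.
Proof. by apply: eq_bigr => i _; rewrite expr2. Qed.

Lemma sqn_lin a b u w :
  sqn (a *: u + b *: w) = a ^+ 2 * sqn u + 2 * a * b * dotv u w + b ^+ 2 * sqn w.
Proof.
rewrite /sqn /dotv !mulr_sumr -!big_split; apply: eq_bigr => i _ /=.
by rewrite !mxE; ring.
Qed.

Lemma sqnZ a v : sqn (a *: v) = a ^+ 2 * sqn v.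
Proof. by rewrite /sqn mulr_sumr; apply: eq_bigr => i _; rewrite mxE exprMn. Qed.

Lemma sqn_ge0 v : 0 <= sqn v.
Proof. by apply: sumr_ge0 => i _; rewrite sqr_ge0. Qed.

Lemma sqn_coord v i : v 0 i ^+ 2 <= sqn v.
Proof.
rewrite /sqn (bigD1 i)//= lerDl.
by apply: sumr_ge0 => j _; rewrite sqr_ge0.
Qed.

Lemma sqn_eq0 v : sqn v = 0 -> v = 0.
Proof.
move=> v0; apply/rowP => i; rewrite mxE; apply/eqP; rewrite -sqrf_eq0 eq_le.
by rewrite sqr_ge0 andbT -v0 sqn_coord.
Qed.

Lemma sqn0 : sqn (0 : 'rV[R]_k) = 0.
Proof. by rewrite /sqn big1// => i _; rewrite mxE expr0n. Qed.

Lemma sqn_gt0 v : v != 0 -> 0 < sqn v.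
Proof.
move=> v0; rewrite lt_neqAle sqn_ge0 andbT eq_sym.
by apply: contra v0 => /eqP/sqn_eq0 ->.
Qed.

Lemma sqn_normM v i j : `|v 0 i| * `|v 0 j| <= sqn v.
Proof.
have := sqn_coord v i; have := sqn_coord v j.
rewrite -(real_normK (num_real (v 0 i))) -(real_normK (num_real (v 0 j))).
by move: `|v 0 i| `|v 0 j| => p q; have := sqr_ge0 (p - q); nra.
Qed.

(** Cauchy-Schwarz, read off from [0 <= sqn (|w|^2 v - (v.w) w)], which expands to
    [|w|^2 (|v|^2 |w|^2 - (v.w)^2)]. *)
Lemma dotv_sqr_le v w : dotv v w ^+ 2 <= sqn v * sqn w.
Proof.
have [->|/sqn_gt0 w0] := eqVneq w 0.
  by rewrite sqn0 mulr0 dotv0r expr0n.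
have := sqn_ge0 (sqn w *: v + (- dotv v w) *: w); rewrite sqn_lin.
rewrite (_ : _ + _ = sqn w * (sqn v * sqn w - dotv v w ^+ 2)); last by ring.
by rewrite pmulr_rge0// subr_ge0.
Qed.

(** The normed-space structure of ['rV[R]_k] carries the maximum norm, whereas the contact
    inequalities are Euclidean. *)
Definition enorm v : R := Num.sqrt (sqn v).

Lemma enorm_ge0 v : 0 <= enorm v.
Proof. exact: sqrtr_ge0. Qed.

Lemma enorm_sqr v : enorm v ^+ 2 = sqn v.
Proof. by rewrite sqr_sqrtr ?sqn_ge0. Qed.

Lemma enorm_le v a : 0 <= a -> sqn v <= a ^+ 2 -> enorm v <= a.
Proof.
move=> a0; rewrite -enorm_sqr => va.
by rewrite -(ler_pXn2r (ltn0Sn 1)) ?nnegrE ?enorm_ge0.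
Qed.

Lemma dotv_le v w : `|dotv v w| <= enorm v * enorm w.
Proof.
rewrite -(ler_pXn2r (ltn0Sn 1)) ?nnegrE ?mulr_ge0 ?enorm_ge0//.
by rewrite real_normK ?num_real// exprMn !enorm_sqr dotv_sqr_le.
Qed.

Lemma enormD v w : enorm (v + w) <= enorm v + enorm w.
Proof.
apply: enorm_le; first by rewrite addr_ge0 ?enorm_ge0.
rewrite -[v]scale1r -[w]scale1r sqn_lin !scale1r -!enorm_sqr.
have := dotv_le v w; rewrite ler_norml => /andP[_]; nra.
Qed.

Lemma projperp_sqn xi w : sqn xi = 1 ->
  sqn (projperp xi w) = sqn w - dotv xi w ^+ 2.
Proof.
move=> xi1; rewrite /projperp -scaleNr -[X in X + _]scale1r sqn_lin xi1.
by rewrite (dotvC w xi); ring.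
Qed.

(** Turns the matrix inequality of the jet into scalar inequalities between linear forms, to which
    the bounds on [gap] apply. *)
Lemma vee_form v xi w :
  (v *m vee xi w *m v^T) 0 0 = dotv v xi * dotv v w.
Proof.
have dE (p q : 'rV[R]_k) : p *m q^T = (dotv p q)%:M.
  apply/matrixP => i j; rewrite !ord1 !mxE mulr1n.
  by apply: eq_bigr => l _; rewrite !mxE.
rewrite /vee -scalemxAr -scalemxAl mulmxDr mulmxDl !mulmxA.
rewrite (dE v xi) (dE v w) !mul_scalar_mx -!scalemxAl !dE !mxE !mulr1n.
by rewrite (dotvC xi v) (dotvC w v); field.
Qed.

(* Twice the largest eigenvalue of [vee xi w] for a unit vector [xi], at least
   in dimension [k >= 2]. *)
Definition gap xi w : R := enorm w + dotv xi w.

Lemma gap_ge0 xi w : sqn xi = 1 -> 0 <= gap xi w.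
Proof.
move=> xi1; have := dotv_le xi w.
by rewrite ler_norml /gap {1}/enorm xi1 sqrtr1 mul1r => /andP[+ _]; lra.
Qed.

(** When nonzero, [enorm w *: xi + w] is an eigenvector of [vee xi w] for the eigenvalue
    [gap xi w / 2]. It is the test vector behind both bounds below. *)
Lemma gap_sqn xi w : sqn xi = 1 ->
  sqn (enorm w *: xi + w) = 2 * enorm w * gap xi w.
Proof.
move=> xi1; rewrite -[X in _ + X]scale1r sqn_lin xi1 -enorm_sqr /gap; ring.
Qed.

Lemma vee_le_gap v xi w : sqn xi = 1 ->
  2 * (dotv v xi * dotv v w) <= gap xi w * sqn v.
Proof.
move=> xi1; have [c0|cn] := eqVneq (enorm w) 0.
  have -> : w = 0 by apply/sqn_eq0; rewrite -enorm_sqr c0 expr0n.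
  by rewrite dotv0r !mulr0 mulr_ge0 ?sqn_ge0 ?gap_ge0.
have c0 : 0 < enorm w by rewrite lt_neqAle eq_sym cn enorm_ge0.
(* With [c = enorm w], [4 c (v.xi) (v.w)] is the difference of the squares of
   [v.(c xi + w)] and [v.(c xi - w)]; the first is bounded by Cauchy-Schwarz. *)
have := dotv_sqr_le v (enorm w *: xi + w); rewrite gap_sqn//.
have -> : dotv v (enorm w *: xi + w) = enorm w * dotv v xi + dotv v w.
  by rewrite -[X in _ + X]scale1r dotv_linr mul1r.
move: (sqr_ge0 (enorm w * dotv v xi - dotv v w)) => h1 h2.
rewrite -(ler_pM2l c0); move: h1 h2.
by move: (dotv v xi) (dotv v w) (gap xi w) (sqn v) (enorm w) => p q g s c; nra.
Qed.

(** Test the form on [c xi + w] with [c = |w|] and [d = xi.w]: the hypothesis reads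
    [c (c + d)^2 <= 2 t c (c + d)], and [c (c + d)] cancels. If it vanishes, the gap is zero and
    [0 <= t] suffices. *)
Lemma gap_le_vee xi w t : sqn xi = 1 -> 0 <= t ->
  (forall v, dotv v xi * dotv v w <= t * sqn v) -> gap xi w <= 2 * t.
Proof.
move=> xi1 t0 H; have := H (enorm w *: xi + w).
have dE u : dotv (enorm w *: xi + w) u = enorm w * dotv u xi + dotv u w.
  by rewrite dotvC -[X in _ + X]scale1r dotv_linr mul1r.
rewrite gap_sqn// !dE -!sqnE xi1 mulr1 (dotvC w xi) -enorm_sqr.
have := gap_ge0 w xi1; have := enorm_ge0 w; rewrite /gap.
set c := enorm w; set d := dotv xi w => c0 g0 h.
have [cz|cn] := eqVneq c 0.
  have w0 : w = 0 by apply/sqn_eq0; rewrite -enorm_sqr -/c cz expr0n.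
  by rewrite /d w0 dotv0r cz addr0 mulr_ge0.
have {cn}cp : 0 < c by rewrite lt_neqAle eq_sym cn.
have [gz|gn] := eqVneq (c + d) 0; first by rewrite gz mulr_ge0.
have gp : 0 < c * (c + d) by rewrite mulr_gt0// lt_neqAle eq_sym gn.
rewrite -(ler_pM2r gp); move: h.
by congr (_ <= _); ring.
Qed.

(** With [d = - xi.v], nonnegative because [e > 0], the hypothesis says [|v|^2 - d^2 <= 2 e d].
    Hence [|v|^2 <= (d + e)^2] and [|v| <= d + e]. *)
Lemma gap_le_projperp xi v e : sqn xi = 1 -> 0 < e ->
  sqn (projperp xi v) <= 2 * e * (- dotv xi v) -> gap xi v <= e.
Proof.
move=> xi1 e0 h; have h0 := le_trans (sqn_ge0 _) h.
have d0 : 0 <= - dotv xi v by move: h0; rewrite pmulr_rge0 ?mulr_gt0.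
rewrite /gap -lerBrDr; apply: enorm_le; first by rewrite addr_ge0// ltW.
by move: h; rewrite projperp_sqn//; have := sqr_ge0 e; nra.
Qed.

(** Subtracting [s xi] leaves the projection unchanged. From [|w| <= t - xi.w] follows
    [|w|^2 - (xi.w)^2 <= t^2 - 2 t (xi.w)], which is at most [2 t (s - xi.w)] as [t <= s]. *)
Lemma projperp_le_gap xi w t s : sqn xi = 1 -> 0 <= t -> t <= s ->
  gap xi w <= t ->
  sqn (projperp xi (w - s *: xi)) <= 2 * t * (- dotv xi (w - s *: xi)).
Proof.
move=> xi1 t0 ts gt.
have dE : dotv xi (w - s *: xi) = dotv xi w - s.
  have := dotv_linr xi 1 (- s) w xi.
  by rewrite scale1r scaleNr mul1r -sqnE xi1 mulr1.
have -> : projperp xi (w - s *: xi) = projperp xi w.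
  by rewrite /projperp dE scalerBl -addrA opprB addKr.
rewrite projperp_sqn// dE -enorm_sqr.
by move: gt (enorm_ge0 w); rewrite /gap; nra.
Qed.

Lemma gap_triangle xi v r : sqn xi = 1 ->
  gap xi (v + r) <= gap xi v + 2 * enorm r.
Proof.
move=> xi1; rewrite /gap dotvDr; have := enormD v r; have := dotv_le xi r.
by rewrite ler_norml {2 3}/enorm xi1 sqrtr1 mul1r => /andP[_]; lra.
Qed.

End Euclid.

(** * Moduli of continuity *)

Section Modulus.
Variable R : realType.
Implicit Types (f F : R -> R) (s t c e : R).

Lemma primitive_of_positive_part f : continuous f ->
  (forall t, t <= 0 -> f t = 0) ->
  exists F, (forall t, t <= 0 -> F t = 0) /\ forall t, is_derive t 1 F (f t).
Proof.
(* Integrating from [-1] instead of [0] makes every [t >= 0] interior to [[-1, t + 1]], so the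
   derivative is two-sided even at [0]; near a negative [t] the primitive vanishes identically. *)
move=> cf f0; pose F x : R := (\int[lebesgue_measure]_(t in `[-1, x]) f t)%R.
have F0 t : t <= 0 -> F t = 0.
  move=> t0; rewrite /F /Rintegral integral0_eq// => s /=.
  by rewrite in_itv/= => /andP[_ st]; rewrite f0// (le_trans st).
exists F; split => // t; have [t0|t0] := ltP t 0.
  rewrite f0 ?ltW//; apply: (near_eq_is_derive (f := cst 0)) => //.
  by near=> s; rewrite F0// ltW//; near: s; exact: lt_nbhsl.
have [] := @continuous_FTC1_closed R f (-1) t (t + 1).
- by rewrite ltrDl.
- apply: continuous_compact_integrable; first exact: segment_compact.
  exact: continuous_subspaceT.
- by rewrite (lt_le_trans _ t0)// oppr_lt0.
- exact: cf.
- by move=> dF; rewrite derive1E => <-; apply: DeriveDef.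
Unshelve. all: by end_near. Qed.

(** [F s - c s^2 / 2] has nonnegative derivative on [(0, t)], hence does not decrease. *)
Lemma quadratic_lower_bound F f c t : 0 < t -> F 0 = 0 ->
  (forall s, is_derive s 1 F (f s)) ->
  (forall s, 0 < s -> s < t -> c * s <= f s) -> c * t ^+ 2 / 2 <= F t.
Proof.
move=> t0 F0 dF H; pose g := F - (c / 2) *: (@id R ^+ 2).
have dg s : is_derive s 1 g (f s - c * s).
  apply: is_derive_eq; rewrite /GRing.scale/= expr1; lra.
suff : g 0 <= g t by rewrite /g !fctE F0 /GRing.scale /=; lra.
apply: (@ger0_derive1_ndecr _ _ 0 t) => //; last exact: ltW.
- by move=> s; rewrite in_itv/= => /andP[s0 st]; rewrite derive1E derive_val subr_ge0 H.
- apply: continuous_subspaceT => s; apply: differentiable_continuous.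
  exact/derivable1_diffP.
Qed.

Lemma quotient_continuous F f : F 0 = 0 -> f 0 = 0 ->
  (forall s, is_derive s 1 F (f s)) -> continuous (fun s => F s / s).
Proof.
move=> F0 f0 dF s; have [->|s0] := eqVneq s 0; last first.
  apply: (@cvgM _ _ _ _ F (fun s => s^-1)); last exact: inv_continuous.
  by apply: differentiable_continuous; apply/derivable1_diffP.
(* Division by zero gives [F 0 / 0 = 0]; elsewhere the quotient is the difference quotient of [F] at
   [0], with limit [f 0 = 0]. *)
apply/continuous_withinNx; rewrite F0 mul0r.
have [dF0 d0] := dF 0; rewrite f0 in d0; rewrite -[X in _ --> X]d0.
move: dF0; rewrite /derive /derivable.
have -> : (fun h => h^-1 *: ((F \o shift 0) (h *: 1) - F 0)) = (fun s => F s / s).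
  by apply/funext => h /=; rewrite F0 subr0 addr0 /GRing.scale/= mulr1 mulrC.
by [].
Qed.

(** For positive [s] and [t], monotonicity of [w] and of [w t / t] (in the opposite sense) squeezes
    [w s] between [min 1 (s / t) * w t] and [max 1 (s / t) * w t]. Only at [0] is the smallness
    hypothesis called for. *)
Lemma monotone_continuous w : (forall t, t <= 0 -> w t = 0) ->
  (forall s t, 0 < s -> s <= t -> w s <= w t) ->
  (forall s t, 0 < s -> s <= t -> s * w t <= t * w s) ->
  (forall e, 0 < e -> exists2 d, 0 < d & forall t, 0 < t -> t < d -> w t <= e) ->
  continuous w.
Proof.
move=> w0 wle wscale wsmall.
have wge0 t : 0 <= w t.
  have [/w0 -> //|t0] := leP t 0.
  (* The chain [w t <= w (2 t) <= 2 w t] forces [w t >= 0]. *)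
  have := wle _ _ (divr_gt0 t0 (ltr0Sn R 1)); have := wscale t (2 * t) t0; have := wle t (2 * t) t0.
  by move: (w t) (w (2 * t)) => p q; nra.
move=> t; rewrite /continuous_at; have [t0|t0|->] := ltgtP t 0.
- rewrite w0 ?ltW//; apply: cvg_near_cst; near=> s; rewrite w0// ltW//.
  by near: s; exact: lt_nbhsl.
- have cs : {for t, continuous (fun s : R => s / t)}.
    apply: cvgM; [exact: cvg_id|exact: cvg_cst].
  have c1 : {for t, continuous (cst 1 : R -> R)} by exact: cvg_cst.
  apply: (@squeeze_cvgr _ _ _ _ (fun s => Num.min (1 : R) (s / t) * w t)
    (fun s => Num.max (1 : R) (s / t) * w t)).
  + near=> s.
    have s0 : 0 < s by near: s; exact: lt_nbhsr.
    have h : s / t * t = s by rewrite divfK ?lt0r_neq0.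
    have r0 : 0 < s / t by rewrite divr_gt0.
    have [st|st] := leP s t.
      have r1 : s / t <= 1 by rewrite ler_pdivrMr// mul1r.
      have := wle _ _ s0 st; have := wscale _ _ s0 st.
      rewrite (min_idPr r1) (max_idPl r1) mul1r => h1 ->; rewrite andbT.
      by rewrite mulrAC ler_pdivrMr// [w s * _]mulrC.
    have r1 : 1 <= s / t by rewrite ler_pdivlMr// mul1r ltW.
    have := wle _ _ t0 (ltW st); have := wscale _ _ t0 (ltW st).
    rewrite (min_idPl r1) (max_idPr r1) mul1r => h1 ->/=.
    by rewrite mulrAC ler_pdivlMr// [w s * _]mulrC.
  + rewrite -[X in _ --> X]mul1r; apply: cvgMl.
    have := continuous_min c1 cs : _ --> Num.min (1 : R) (t / t).
    by rewrite divff ?lt0r_neq0// minxx.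
  + rewrite -[X in _ --> X]mul1r; apply: cvgMl.
    have := continuous_max c1 cs : _ --> Num.max (1 : R) (t / t).
    by rewrite divff ?lt0r_neq0// maxxx.
- rewrite w0//; apply/cvgrPdist_le => e e0.
  have [d d0 H] := wsmall e e0; near=> s.
  rewrite sub0r normrN ger0_norm//; have [s0|s0] := leP s 0.
    by rewrite w0// ltW.
  by apply: H => //; near: s; exact: lt_nbhsl.
Unshelve. all: by end_near. Qed.

(* The infimum of the affine functions [e + t / d e] is concave, which gives continuity and
   the sublinear scaling. *)
Lemma concave_modulus (d : R -> R) : (forall e, 0 < e -> 0 < d e) ->
  exists w : R -> R, [/\ continuous w, (forall t, t <= 0 -> w t = 0),
    (forall s t, 0 < s -> s <= t -> s * w t <= t * w s) &
    (forall t c, 0 < t -> (forall e, 0 < e -> c <= e + t / d e) -> c <= w t)].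
Proof.
move=> d0; pose E t := [set e + t / d e | e in [set e | 0 < e]].
pose w t := if t <= 0 then 0 else inf (E t).
have E0 t : E t !=set0 by exists (1 + t / d 1), 1 => /=.
have wle t e : 0 < t -> 0 < e -> w t <= e + t / d e.
  move=> t0 e0; rewrite /w (leNgt t 0) t0/=; apply: ge_inf; last by exists e.
  by exists 0 => _ [a /= a0 <-]; rewrite addr_ge0 ?divr_ge0 ?ltW ?d0.
have wge t c : 0 < t -> (forall e, 0 < e -> c <= e + t / d e) -> c <= w t.
  by move=> t0 H; rewrite /w (leNgt t 0) t0/=; apply: lb_le_inf => // _ [a /= a0 <-]; exact: H.
have wscale s t : 0 < s -> s <= t -> s * w t <= t * w s.
  move=> s0 st; have t0 := lt_le_trans s0 st.
  (* Each affine function is positive at [0], so its quotient by [t] decreases; the infimum inherits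
     this. *)
  rewrite -ler_pdivrMl//; apply: wge => // e e0.
  have := wle t e t0 e0; rewrite -(ler_pM2l s0) => h.
  rewrite mulrC ler_pdivrMr// (le_trans h)//.
  have : 0 < t / d e by rewrite divr_gt0 ?d0.
  by move: (d e)^-1 => a; nra.
exists w; split => //; last first.
  by move=> t t0; rewrite /w t0.
apply: monotone_continuous => //.
- by move=> t t0; rewrite /w t0.
- move=> s t s0 st; apply: wge; first exact: lt_le_trans st.
  move=> e e0; apply: (le_trans (wle _ _ s0 e0)).
  by rewrite lerD2l ler_pM2r// invr_gt0 d0.
(* With parameter [e / 2], the constant and the linear term each contribute at most [e / 2]. *)
- move=> e e0; have e2 : 0 < e / 2 by rewrite divr_gt0.
  exists (e / 2 * d (e / 2)); first by rewrite mulr_gt0// d0.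
  move=> t t0 te; apply: (le_trans (wle _ _ t0 e2)).
  have : t / d (e / 2) <= e / 2 by rewrite ler_pdivrMr ?d0// ltW.
  lra.
Qed.

(* [w1] is the running average of the modulus [w0]: its derivative [(w0 - w1) / t] is
   singular at [0], but only mildly enough for [G (|h|^2)] to be of class [C^2]. *)
Lemma modulus_primitives (d : R -> R) : (forall e, 0 < e -> 0 < d e) ->
  exists G w1 w0 : R -> R,
    [/\ G 0 = 0 /\ w1 0 = 0 /\ w0 0 = 0, continuous w0 /\ continuous w1,
    (forall t, is_derive t 1 G (w1 t)),
    (forall t, t != 0 -> is_derive t 1 w1 ((w0 t - w1 t) / t)) &
    (forall t c, 0 < t -> (forall e, 0 < e -> c <= e + t / d e) ->
      c * t / 4 <= G t)].
Proof.
move=> /concave_modulus[w [cw w0 wscale wge]].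
have [F [F0 dF]] := primitive_of_positive_part cw w0.
pose w1 t := F t / t.
have cw1 : continuous w1.
  by apply: (@quotient_continuous F w); [exact: F0|exact: w0].
have w10 t : t <= 0 -> w1 t = 0 by move=> t0; rewrite /w1 F0// mul0r.
have [G [G0 dG]] := primitive_of_positive_part cw1 w10.
exists G, w1, w; split => //.
- by rewrite G0// w10// w0.
- move=> t t0; have dV := @is_deriveV _ id t 1 1 t0 (is_derive_id _ _).
  apply: (is_derive_eq (is_deriveM (dF t) dV)).
  by rewrite /w1 /GRing.scale/=; field.
- move=> t c t0 /wge -/(_ t0) cw0; have t0n := lt0r_neq0 t0.
  (* On [(0, t)] the scaling gives [w r >= (w t / t) r]. Two integrations, with a division by [s] in
     between, yield [w1 s >= (w t / t) s / 2] and [G t >= w t * t / 4]: this is the constant [4]. *)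
  have w1ge s : 0 < s -> s < t -> w t / t / 2 * s <= w1 s.
    move=> s0 st; rewrite /w1 ler_pdivlMr//.
    rewrite (_ : _ * s * s = w t / t * s ^+ 2 / 2); last by ring.
    apply: (@quadratic_lower_bound F w) => //; first exact: F0.
    move=> r r0 rs; rewrite mulrAC ler_pdivrMr// [_ * r]mulrC [w r * _]mulrC.
    by apply: wscale => //; rewrite ltW// (lt_trans rs).
  have := @quadratic_lower_bound G w1 _ t t0 (G0 _ (lexx _)) dG w1ge.
  apply: le_trans; rewrite (_ : _ / 2 = w t * t / 4); last by field.
  by rewrite ler_pM2r// ler_pM2r.
Qed.

End Modulus.

(** * Calculus with partial derivatives *)

Section DirectionalDerivatives.
Variables (R : realType) (V : normedModType R).
Implicit Types (f k l : V -> R) (y v : V) (s : R).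

Lemma is_derive_line f y v s df : is_derive (y + s *: v) v f df <->
  is_derive s 1 (fun r => f (y + r *: v)) df.
Proof.
have qE : (fun h => h^-1 *: ((f \o shift (y + s *: v)) (h *: v) - f (y + s *: v)))
    = (fun h : R => h^-1 *: (((fun r => f (y + r *: v)) \o shift s) (h *: 1) -
          f (y + s *: v))).
  by apply/funext => h /=; rewrite scalerDl addrCA /GRing.scale/= mulr1.
by split=> -[d e]; split; move: d e; rewrite /derivable /derive qE.
Qed.

Lemma is_derive_quadratic f y v b c :
  (forall s, f (y + s *: v) = f y + s * b + s ^+ 2 * c) -> is_derive y v f b.
Proof.
move=> H.
have Hb : (fun h => h^-1 *: ((f \o shift y) (h *: v) - f y)) @ 0^' --> b.
  have cb : b + h * c @[h --> (0 : R)^'] --> b.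
    rewrite -[X in _ --> X]addr0 -[X in _ --> _ + X](mul0r c).
    apply: cvgD; first exact: cvg_cst.
    by apply: cvgMl; apply: cvg_within_filter; exact: cvg_id.
  apply: cvg_trans cb; apply: near_eq_cvg; near=> h.
  have h0 : h != 0 by near: h; exact: nbhs_dnbhs_neq.
  by rewrite /= (addrC (h *: v)) H /GRing.scale/=; field.
by split; [apply/cvg_ex; eexists; exact: Hb|exact: cvg_lim Hb].
Unshelve. all: by end_near. Qed.

Lemma is_derive_comp_scalar f (G : R -> R) y v a b :
  is_derive (f y) 1 G a -> is_derive y v f b -> is_derive y v (G \o f) (a * b).
Proof.
rewrite -{1 2}[y]addr0 -(scale0r v) => dG /is_derive_line df.
rewrite -[y]addr0 -(scale0r v); apply/is_derive_line.
exact: (is_derive1_comp dG df).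
Qed.

Lemma is_derive_mul_vanishing k l y v b :
  {for y, continuous k} -> l y = 0 -> is_derive y v l b ->
  is_derive y v (fun z => k z * l z) (k y * b).
Proof.
move=> ck l0 [dl lb].
have H : (fun h => h^-1 *: (((fun z => k z * l z) \o shift y) (h *: v) - k y * l y))
    @ 0^' --> k y * b.
  rewrite (_ : (fun h => _) = fun h => k (h *: v + y) * 
      (h^-1 *: ((l \o shift y) (h *: v) - l y))); last first.
    by apply/funext => h /=; rewrite l0 mulr0 !subr0 /GRing.scale/=; ring.
  have hv : h *: v + y @[h --> (0 : R)] --> y.
    rewrite -[X in _ --> X]add0r -[X in _ --> X + _](scale0r v).
    by apply: cvgD; [apply: cvgZr_tmp; exact: cvg_id|exact: cvg_cst].
  apply: cvgM; last by rewrite -lb; exact: dl.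
  apply: cvg_within_filter; exact: (cvg_comp _ _ hv ck).
by split; [apply/cvg_ex; eexists; exact: H|exact: cvg_lim H].
Qed.

End DirectionalDerivatives.

(** * Mean value estimates and symmetry of second derivatives *)

Section MeanValue.
Variables (R : realType) (n : nat).
Implicit Types (f : 'rV[R]_n -> R) (x y h : 'rV[R]_n) (c M : R).

Lemma mean_value_abs (f df : R -> R) (b M : R) :
  (forall s : R, is_derive s 1 f (df s)) ->
  (forall s, `|s| <= `|b| -> `|df s| <= M) -> `|f b - f 0| <= M * `|b|.
Proof.
move=> fdf dfM.
have cf p : {within p, continuous f}.
  apply: continuous_subspaceT => s; apply: differentiable_continuous.
  exact/derivable1_diffP.
have [b0|b0] := leP 0 b.
  have [s] := @MVT_segment R f df 0 b b0 (fun s _ => fdf s) (cf _).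
  rewrite in_itv/= => /andP[s0 sb] ->; rewrite subr0 normrM.
  by rewrite ler_wpM2r ?dfM// !ger0_norm.
have [s] := @MVT_segment R f df b 0 (ltW b0) (fun s _ => fdf s) (cf _).
rewrite in_itv/= => /andP[bs s0]; rewrite distrC => ->; rewrite sub0r normrM normrN.
by rewrite ler_wpM2r ?dfM// !ler0_norm ?lerN2// ltW.
Qed.

(** Only partial derivatives are given, so the path from [x] to [x + h] changes one coordinate at a
    time; [hk k] keeps the first [k] coordinates of [h], and each of the [n] legs costs at most
    [M * c]. *)
Lemma mean_value_box f (df : 'I_n -> 'rV[R]_n -> R) x h c M :
  (forall i y, is_derive y (ebasis R i) f (df i y)) ->
  (forall y, (forall i, `|(y - x) 0 i| <= c) -> forall i, `|df i y| <= M) ->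
  (forall i, `|h 0 i| <= c) ->
  `|f (x + h) - f x| <= n%:R * (M * c).
Proof.
move=> fdf dfM hc; pose hk (k : nat) : 'rV[R]_n := \row_i (if (i < k)%N then h 0 i else 0).
suff H k : (k <= n)%N -> `|f (x + hk k) - f x| <= k%:R * (M * c).
  have -> : h = hk n by apply/rowP => i; rewrite mxE ltn_ord.
  exact: H.
elim: k => [_|k IH kn].
  have -> : hk 0 = 0 by apply/rowP => i; rewrite !mxE.
  by rewrite addr0 subrr normr0 mul0r.
pose i := Ordinal kn.
have hkS : hk k.+1 = hk k + h 0 i *: ebasis R i.
  apply/rowP => j; rewrite !mxE eqxx/= ltnS leq_eqVlt.
  have [->|ji] := eqVneq j i; first by rewrite eqxx ltnn mulr1 add0r.
  by rewrite (negbTE ji : (j == k :> nat) = false)/= mulr0 addr0.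
rewrite -(subrKA (f (x + hk k))) (le_trans (ler_normD _ _))//.
rewrite -natr1 mulrDl mul1r [leRHS]addrC lerD ?IH ?(ltnW kn)//.
have mv := @mean_value_abs (fun r => f (x + hk k + r *: ebasis R i))
  (fun r => df i (x + hk k + r *: ebasis R i)) (h 0 i) M.
rewrite /= scale0r addr0 in mv; rewrite hkS addrA (le_trans (mv _ _))//.
- move=> s; exact ((is_derive_line f _ _ s _).1 (fdf i _)).
- move=> s sh; apply: dfM => j.
  rewrite -(addrA x) addrAC subrr add0r !mxE eqxx/=.
  have [->|ji] := eqVneq j i; first by rewrite ltnn add0r mulr1 (le_trans sh).
  by rewrite mulr0 addr0; case: ifP => // _; rewrite normr0 (le_trans _ (hc j)).
- rewrite ler_wpM2l// (le_trans _ (dfM x _ i))// => j.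
  by rewrite subrr mxE normr0 (le_trans _ (hc j)).
Qed.

Lemma near_box x (P : set 'rV[R]_n) : (\forall y \near x, P y) ->
  exists2 d : R, 0 < d & forall y, (forall i, `|(y - x) 0 i| < d) -> P y.
Proof.
move=> /nbhs_ballP[d /= d0 dP]; exists d => // y yd; apply: dP; split => // i j.
by rewrite ord1 /ball/= distrC; have := yd j; rewrite !mxE.
Qed.

(** The mean value theorem is applied first along [i] to the increment of [f] in direction [j], then
    along [j] to [partial i f]. The bound [2 * s] covers [i = j], when both displacements fall on
    the same coordinate. *)
Lemma second_difference f x i j (s : R) : 0 < s ->
  (forall i y, derivable f y (ebasis R i)) ->
  (forall i j y, derivable (partial i f) y (ebasis R j)) ->
  exists2 y, forall k, `|(y - x) 0 k| <= 2 * s &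
    f (x + s *: ebasis R j + s *: ebasis R i) - f (x + s *: ebasis R i)
    - (f (x + s *: ebasis R j) - f x) = s ^+ 2 * partial j (partial i f) y.
Proof.
move=> s0 df ddf.
have mv (phi dphi : R -> R) : (forall r : R, is_derive r 1 phi (dphi r)) ->
    exists2 r, 0 <= r <= s & phi s - phi 0 = s * dphi r.
  move=> dphiE; have cphi : {within `[0, s], continuous phi}.
    apply: continuous_subspaceT => r; apply: differentiable_continuous.
    exact/derivable1_diffP.
  have [r rs e] := MVT_segment (ltW s0) (fun r _ => dphiE r) cphi.
  by exists r; [move: rs; rewrite in_itv|rewrite e subr0 mulrC].
have dline g k y r : derivable g (y + r *: ebasis R k) (ebasis R k) ->
    is_derive r 1 (fun r => g (y + r *: ebasis R k)) (partial k g (y + r *: ebasis R k)).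
  by move=> dg; exact ((is_derive_line g y _ r _).1 (derivableP dg)).
have [a /andP[a0 as_] e1] := mv (fun r => f (x + s *: ebasis R j + r *: ebasis R i) -
    f (x + r *: ebasis R i)) _
  (fun r => is_deriveB (dline f i _ r (df _ _)) (dline f i _ r (df _ _))).
have [b /andP[b0 bs] e2] := mv (fun r => partial i f (x + a *: ebasis R i + r *: ebasis R j))
  _ (fun r => dline _ j _ r (ddf _ _ _)).
exists (x + a *: ebasis R i + b *: ebasis R j).
  move=> k; rewrite -(addrA x) addrAC subrr add0r !mxE eqxx/=.
  rewrite (le_trans (ler_normD _ _))// mulr2n mulrDl !mul1r lerD//.
    by case: eqP => _; rewrite ?mulr1 ?mulr0 ?normr0 ?ger0_norm// ltW.
  by case: eqP => _; rewrite ?mulr1 ?mulr0 ?normr0 ?ger0_norm// ltW.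
move: e1; rewrite !scale0r !addr0 => ->.
by move: e2; rewrite scale0r addr0 (addrAC x) => ->; rewrite mulrA expr2.
Qed.

(** Schwarz's theorem: the second difference is symmetric in [i] and [j], so the two mixed
    derivatives agree at points [y1] and [y2] close to [x], and continuity carries this to [x]. *)
Lemma partial_comm f i j x : C2 f ->
  partial j (partial i f) x = partial i (partial j f) x.
Proof.
have tri (e a b c c' : R) : `|a - c| <= e / 2 -> `|b - c'| <= e / 2 -> c = c' ->
    `|a - b| <= 0 + e.
  move=> ac bc cc; rewrite add0r (splitr e) (le_trans (ler_distD c _ _))//.
  by rewrite lerD// distrC cc.
move=> [_ [df [_ [ddf cddf]]]].
apply/eqP; rewrite -subr_eq0 -normr_le0; apply/ler_addgt0Pr => e e0.
have e2 : 0 < e / 2 by rewrite divr_gt0.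
have /cvgrPdist_le/(_ _ e2)/near_box[d1 d10 h1] := cddf i j x.
have /cvgrPdist_le/(_ _ e2)/near_box[d2 d20 h2] := cddf j i x.
pose s := Num.min d1 d2 / 4.
have m0 : 0 < Num.min d1 d2 by rewrite lt_min d10.
have s0 : 0 < s by rewrite divr_gt0.
have : 2 * s < Num.min d1 d2 by rewrite /s; lra.
rewrite lt_min => /andP[sd1 sd2].
have [y1 y1s E1] := second_difference x i j s0 df ddf.
have [y2 y2s E2] := second_difference x j i s0 df ddf.
have yy : partial j (partial i f) y1 = partial i (partial j f) y2.
  have s2 : s ^+ 2 != 0 by rewrite expf_neq0 ?lt0r_neq0.
  apply: (@mulfI R (s ^+ 2) s2); apply: (etrans (esym E1)).
  by apply: (etrans _ E2); rewrite (addrAC x); ring.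
have k1 := h1 y1 (fun k => le_lt_trans (y1s k) sd1).
have k2 := h2 y2 (fun k => le_lt_trans (y2s k) sd2).
exact: (tri _ _ _ _ _ k1 k2 yy).
Qed.

End MeanValue.

(** * Quadratic polynomials and the second-order Taylor expansion *)

Section Taylor.
Variables (R : realType) (n : nat).
Implicit Types (f : 'rV[R]_n -> R) (x y z h p v : 'rV[R]_n) (X : 'M[R]_n).

Definition quadratic_poly p X h : R := dotv h p + 2^-1 * (h *m X *m h^T) 0 0.

(** Symmetry of [X] merges the two cross terms. Along every line the polynomial is exactly
    quadratic, the form that [is_derive_quadratic] expects. *)
Lemma quadratic_poly_shift p X h s v : X^T = X ->
  quadratic_poly p X (h + s *: v) = quadratic_poly p X h +
    s * (dotv v p + (h *m X *m v^T) 0 0) + s ^+ 2 * (2^-1 * (v *m X *m v^T) 0 0).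
Proof.
move=> sX; have vh : (v *m X *m h^T) 0 0 = (h *m X *m v^T) 0 0.
  rewrite (_ : v *m X *m h^T = (h *m X *m v^T)^T); first by rewrite mxE.
  by rewrite !trmx_mul trmxK sX mulmxA.
rewrite /quadratic_poly dotvC dotvDr.
have := dotv_linr p s 0 v v; rewrite scale0r addr0 mul0r addr0 => ->.
rewrite !(dotvC p) linearD/= linearZ/= !mulmxDl !mulmxDr -!scalemxAl -!scalemxAr.
move: vh; move: (v *m X *m h^T) (h *m X *m v^T) (h *m X *m h^T) (v *m X *m v^T).
by move=> A B C D AB; rewrite !mxE AB; field.
Qed.

Lemma ebasis_mul X h i : (h *m X *m (ebasis R i)^T) 0 0 = (h *m X) 0 i.
Proof. by rewrite /ebasis trmx_delta -colE mxE. Qed.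

Lemma dotv_ebasis v i : dotv (ebasis R i) v = v 0 i.
Proof.
rewrite /dotv (bigD1 i)//= big1 ?mxE ?eqxx ?mul1r ?addr0// => j ji.
by rewrite mxE (negbTE ji) andbF mul0r.
Qed.

Lemma is_derive_quadratic_poly p X x y i : X^T = X ->
  is_derive y (ebasis R i) (fun z => quadratic_poly p X (z - x))
    ((p + (y - x) *m X) 0 i).
Proof.
move=> sX; apply: is_derive_quadratic => s.
by rewrite addrAC quadratic_poly_shift// dotv_ebasis ebasis_mul [in RHS]mxE.
Qed.

Lemma is_derive_affine p X x y i j :
  is_derive y (ebasis R j) (fun z => (p + (z - x) *m X) 0 i) (X j i).
Proof.
apply: (@is_derive_quadratic _ _ _ _ _ _ 0) => s.
rewrite mulr0 addr0 addrAC mulmxDl -scalemxAl -rowE addrA [LHS]mxE; congr (_ + _).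
by rewrite !mxE.
Qed.

Lemma continuous_sum_ord m (T : topologicalType) (F : 'I_m -> T -> R) :
  (forall i, continuous (F i)) -> continuous (fun a => \sum_i F i a).
Proof. by move=> cF a; apply: cvg_big => [|i _]; [exact: add_continuous|exact: cF]. Qed.

Lemma continuous_sqn : continuous (@sqn R n).
Proof.
apply: continuous_sum_ord => i y.
apply: (@cvg_comp _ _ _ (fun z : 'rV[R]_n => z 0 i) (fun r => r ^+ 2)).
  exact: coord_continuous.
exact: exprn_continuous.
Qed.

Lemma continuous_enorm : continuous (@enorm R n).
Proof. by move=> y; apply: continuous_comp; [exact: continuous_sqn|exact: sqrt_continuous]. Qed.

Lemma near_enorm_lt x (d : R) : 0 < d -> \forall z \near x, enorm (z - x) < d.
Proof.
move=> d0; have cx : z - x @[z --> x] --> x - x.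
  exact (cvgB (F := nbhs x) cvg_id (cvg_cst x)).
have := cvg_comp _ _ cx (@continuous_enorm (x - x)).
rewrite subrr /enorm sqn0 sqrtr0 -/(enorm _).
by move=> /cvgrPdist_lt/(_ _ d0); apply: filterS => z; rewrite sub0r normrN ger0_norm ?enorm_ge0.
Qed.

Lemma coord_le_enorm v i : `|v 0 i| <= enorm v.
Proof. by rewrite -sqrtr_sqr ler_wsqrtr// sqn_coord. Qed.

(** The remainder [r] has zero 2-jet at [x] and second derivatives at most [eta] nearby. With
    [c = |z - x|], [mean_value_box] gives [|dr| <= n eta c], and once more [|r| <= n^2 eta c^2]. *)
Lemma taylor2 f x (e : R) : C2 f -> 0 < e ->
  \forall z \near x, `|f z - f x - quadratic_poly (\row_i partial i f x)
    (\matrix_(i, j) partial j (partial i f) x) (z - x)| <= e * sqn (z - x).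
Proof.
move=> Cf e0; have [_ [df [_ [ddf cddf]]]] := Cf.
set p := \row_i _; set X := \matrix_(i, j) _.
have sX : X^T = X by apply/matrixP => i j; rewrite !mxE partial_comm.
pose r z := f z - quadratic_poly p X (z - x).
pose dr i z := partial i f z - (p + (z - x) *m X) 0 i.
pose ddr i j z := partial j (partial i f) z - X j i.
have rE i y : is_derive y (ebasis R i) r (dr i y).
  by apply: is_deriveB; [exact: derivableP|exact: is_derive_quadratic_poly].
have drE i j y : is_derive y (ebasis R j) (dr i) (ddr i j y).
  by apply: is_deriveB; [exact: derivableP|exact: is_derive_affine].
(* The added [1] keeps the denominator positive when [n = 0]. *)
pose eta := e / (n%:R * n%:R + 1).
have n1 : 0 < n%:R * n%:R + 1 :> R by rewrite ltr_wpDl ?mulr_ge0.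
have eta0 : 0 < eta by rewrite divr_gt0.
have etae : n%:R * n%:R * eta <= e.
  by rewrite /eta mulrA ler_pdivrMr// mulrC ler_pM2l// lerDl.
have [d d0 H] : exists2 d : R, 0 < d & forall y, (forall i, `|(y - x) 0 i| < d) ->
    forall i j, `|ddr i j y| <= eta.
  have near_ij i j : \forall y \near x, `|ddr i j y| <= eta.
    have /cvgrPdist_le/(_ _ eta0) := cddf i j x; apply: filterS => y.
    by rewrite /ddr distrC -[X]sX !mxE.
  exact (near_box (filter_forall (F := nbhs x) _ (fun i => filter_forall _ (near_ij i)))).
have := near_enorm_lt x d0; apply: filterS => z zd.
set c := enorm (z - x).
have c0 : 0 <= c by exact: enorm_ge0.
have hdr y : (forall i, `|(y - x) 0 i| <= c) -> forall i, `|dr i y| <= n%:R * (eta * c).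
  move=> yc i; have := @mean_value_box _ _ (dr i) (ddr i) x (y - x) c eta (drE i) _ yc.
  rewrite (addrC x) subrK {2}/dr subrr mul0mx addr0 /p mxE subrr subr0; apply.
  by move=> w wc j; apply: H => k; rewrite (le_lt_trans (wc k)).
have := @mean_value_box _ _ r dr x (z - x) c _ rE hdr (coord_le_enorm _).
rewrite (addrC x) subrK {2}/r subrr /quadratic_poly mul0mx mul0mx mxE mulr0 addr0.
have -> : dotv 0 p = 0 by rewrite dotvC dotv0r.
rewrite subr0 -/(quadratic_poly _ _ _) /r addrAC => /le_trans; apply.
rewrite -enorm_sqr -/c expr2 (_ : _ * _ = n%:R * n%:R * eta * (c * c)); last by ring.
by rewrite ler_wpM2r// mulr_ge0.
Qed.

Lemma C2_intro f (D1 : 'I_n -> 'rV[R]_n -> R) (D2 : 'I_n -> 'I_n -> 'rV[R]_n -> R) :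
  (forall i y, is_derive y (ebasis R i) f (D1 i y)) ->
  (forall i j y, is_derive y (ebasis R j) (D1 i) (D2 i j y)) ->
  continuous f -> (forall i, continuous (D1 i)) -> (forall i j, continuous (D2 i j)) ->
  [/\ C2 f, forall i, partial i f = D1 i & forall i j, partial j (partial i f) = D2 i j].
Proof.
move=> df ddf cf cdf cddf.
have p1 i : partial i f = D1 i by apply/funext => y; exact: derive_val.
have p2 i j : partial j (partial i f) = D2 i j.
  by apply/funext => y; rewrite p1; exact: derive_val.
split => //; split => //; split; first by move=> i y; have [] := df i y.
split; first by move=> i; rewrite p1.
by split=> [i j y|i j]; [rewrite p1; have [] := ddf i j y|rewrite p2].
Qed.

End Taylor.

(** * Functions of class C^2: quadratic polynomials, affine combinations, radial functions *)

Section C2Examples.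
Variables (R : realType) (n : nat).
Implicit Types (f g : 'rV[R]_n -> R) (x y z h p v : 'rV[R]_n) (X : 'M[R]_n).

Lemma continuous_coord_sub x i : continuous (fun z => (z - x) 0 i).
Proof.
move=> y; have cx : z - x @[z --> y] --> y - x.
  exact (cvgB (F := nbhs y) cvg_id (cvg_cst x)).
exact: (cvg_comp _ _ cx (@coord_continuous _ _ _ 0 i (y - x))).
Qed.

Lemma continuous_sqn_sub x : continuous (fun z => sqn (z - x)).
Proof.
move=> y; have cx : z - x @[z --> y] --> y - x.
  exact (cvgB (F := nbhs y) cvg_id (cvg_cst x)).
exact: (cvg_comp _ _ cx (@continuous_sqn _ _ (y - x))).
Qed.

Lemma continuous_affine p X x i : continuous (fun z => (p + (z - x) *m X) 0 i).
Proof.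
rewrite (_ : (fun z => _) = fun z => p 0 i + \sum_k (z - x) 0 k * X k i); last first.
  by apply/funext => z; rewrite !mxE.
have cS : continuous (fun z => \sum_k (z - x) 0 k * X k i).
  apply: continuous_sum_ord => k y.
  exact (cvgM (F := nbhs y) (@continuous_coord_sub x k y) (cvg_cst _)).
by move=> y; exact (cvgD (F := nbhs y) (cvg_cst _) (cS y)).
Qed.

Lemma continuous_quadratic_poly p X x :
  continuous (fun z => quadratic_poly p X (z - x)).
Proof.
(* Factoring out one coordinate leaves a sum of products of affine functions. *)
rewrite (_ : (fun z => _) = fun z => \sum_k (z - x) 0 k * (p + (z - x) *m (2^-1 *: X)) 0 k).
  apply: continuous_sum_ord => k y.
  exact (cvgM (F := nbhs y) (@continuous_coord_sub x k y) (@continuous_affine _ _ _ _ y)).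
apply/funext => z; rewrite /quadratic_poly /dotv mxE mulr_sumr -big_split.
by apply: eq_bigr => k _ /=; rewrite -scalemxAr !mxE; ring.
Qed.

Lemma C2_quadratic_poly p X x : X^T = X ->
  [/\ C2 (fun z => quadratic_poly p X (z - x)),
    forall i, partial i (fun z => quadratic_poly p X (z - x)) x = p 0 i &
    forall i j, partial j (partial i (fun z => quadratic_poly p X (z - x))) x = X i j].
Proof.
move=> sX.
have [|||||C p1 p2] := @C2_intro _ _ (fun z => quadratic_poly p X (z - x))
  (fun i z => (p + (z - x) *m X) 0 i) (fun i j z => X j i).
- by move=> i y; apply: is_derive_quadratic_poly.
- by move=> i j y; apply: is_derive_affine.
- exact: continuous_quadratic_poly.
- by move=> i; exact: continuous_affine.
- by move=> i j; exact: cst_continuous.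
split => // [i|i j]; first by rewrite p1 subrr mul0mx addr0.
by rewrite p2 -[in LHS]sX mxE.
Qed.

Lemma C2_affine_comb f g (a c : R) : C2 f -> C2 g ->
  [/\ C2 (fun z => c + f z + a * g z),
    forall i y, partial i (fun z => c + f z + a * g z) y = partial i f y + a * partial i g y &
    forall i j y, partial j (partial i (fun z => c + f z + a * g z)) y =
      partial j (partial i f) y + a * partial j (partial i g) y].
Proof.
move=> [cf [df [cdf [ddf cddf]]]] [cg [dg [cdg [ddg cddg]]]].
have cvg_comb (F H : 'rV[R]_n -> R) : continuous F -> continuous H ->
    continuous (fun z => F z + a * H z).
  move=> cF cH y; apply: (cvgD (F := nbhs y)); first exact: cF.
  exact (cvgM (F := nbhs y) (cvg_cst a) (cH y)).
have is_derive_comb (F H : 'rV[R]_n -> R) b y v : derivable F y v -> derivable H y v ->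
    is_derive y v (fun z => b + F z + a * H z) ('D_v F y + a * 'D_v H y).
  move=> /derivableP dF /derivableP dH.
  have := is_deriveD (is_deriveD (is_derive_cst b y v) dF) (is_deriveZ a dH).
  by rewrite add0r.
have [|||||C p1 p2] := @C2_intro _ _ (fun z => c + f z + a * g z)
  (fun i z => partial i f z + a * partial i g z)
  (fun i j z => partial j (partial i f) z + a * partial j (partial i g) z).
- by move=> i y; exact: is_derive_comb.
- move=> i j y; have := is_derive_comb (partial i f) (partial i g) 0 y _ (ddf i j y) (ddg i j y).
  by congr (is_derive _ _ _ _); apply/funext => z; rewrite add0r.
- apply: cvg_comb => // y.
  exact (cvgD (F := nbhs y) (cvg_cst c) (cf y)).
- by move=> i; apply: cvg_comb.
- by move=> i j; apply: cvg_comb.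
by split; [exact: C|move=> i y; rewrite p1|move=> i j y; rewrite p2].
Qed.

Lemma is_derive_coord_sub x y i j :
  is_derive y (ebasis R j) (fun z => (z - x) 0 i) (i == j)%:R.
Proof.
apply: (@is_derive_quadratic _ _ _ _ _ _ 0) => s.
by rewrite !mxE mulr0 addr0 eqxx/= addrAC.
Qed.

Lemma is_derive_sqn_sub x y i :
  is_derive y (ebasis R i) (fun z => sqn (z - x)) (2 * (y - x) 0 i).
Proof.
apply: (@is_derive_quadratic _ _ _ _ _ _ (sqn (ebasis R i))) => s.
rewrite addrAC -[X in X + _]scale1r sqn_lin dotvC dotv_ebasis; ring.
Qed.

Variables (G w1 w0 : R -> R).
Hypotheses (cw0 : continuous w0) (cw1 : continuous w1).
Hypotheses (w00 : w0 0 = 0) (w10 : w1 0 = 0).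
Hypothesis dG : forall t : R, is_derive t 1 G (w1 t).
Hypothesis dw1 : forall t : R, t != 0 -> is_derive t 1 w1 ((w0 t - w1 t) / t).

(** First and second partial derivatives of [G (sqn (z - x))], by the chain rule and
    [t w1'(t) = w0 t - w1 t]. At [z = x] division by zero returns [0] and [w1 0 = 0], so [D2] has
    the correct value [0] there. *)
Let D1 x i z := 2 * w1 (sqn (z - x)) * (z - x) 0 i.
Let D2 x i j z := 4 * (w0 (sqn (z - x)) - w1 (sqn (z - x))) *
  ((z - x) 0 i * (z - x) 0 j / sqn (z - x)) + 2 * w1 (sqn (z - x)) * (i == j)%:R.

Let continuous_comp_sqn (w : R -> R) x : continuous w -> continuous (fun z => w (sqn (z - x))).
Proof. by move=> cw y; exact: (cvg_comp _ _ (@continuous_sqn_sub x y) (cw _)). Qed.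

Let is_derive_D1 x i j y : is_derive y (ebasis R j) (D1 x i) (D2 x i j y).
Proof.
have c2w1 : continuous (fun z => 2 * w1 (sqn (z - x))).
  by move=> z; exact (cvgM (F := nbhs z) (cvg_cst _) (@continuous_comp_sqn _ x cw1 z)).
have [->|yx] := eqVneq y x.
  have h0 : (x - x) 0 i = 0 by rewrite subrr mxE.
  apply: (is_derive_eq (is_derive_mul_vanishing (c2w1 x) h0 (is_derive_coord_sub x x i j))).
  by rewrite /D2 subrr sqn0 w00 w10 subrr !mulr0 !mul0r addr0.
have q0 : sqn (y - x) != 0 by rewrite gt_eqF// sqn_gt0// subr_eq0.
have dw := is_derive_comp_scalar (f := fun z => sqn (z - x)) (dw1 q0) (is_derive_sqn_sub x y j).
have d := is_deriveM (is_deriveZ 2 dw) (is_derive_coord_sub x y i j).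
apply: (is_derive_eq d); rewrite /D2 /GRing.scale/= /GRing.scale/=.

by field.
Qed.

Let continuous_D2 x i j : continuous (D2 x i j).
Proof.
have cd : continuous (fun z => 4 * (w0 (sqn (z - x)) - w1 (sqn (z - x)))).
  move=> z; apply: (cvgM (F := nbhs z) (cvg_cst _)).
  exact (cvgB (F := nbhs z) (@continuous_comp_sqn _ x cw0 z) (@continuous_comp_sqn _ x cw1 z)).
have c1 : continuous (fun z => 2 * w1 (sqn (z - x)) * (i == j)%:R).
  move=> z; apply: (cvgM (F := nbhs z) _ (cvg_cst _)).
  exact (cvgM (F := nbhs z) (cvg_cst _) (@continuous_comp_sqn _ x cw1 z)).
move=> y; apply: (cvgD (F := nbhs y)) (c1 y); have [->|yx] := eqVneq y x; last first.
  have q0 : sqn (y - x) != 0 by rewrite gt_eqF// sqn_gt0// subr_eq0.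
  apply: (cvgM (F := nbhs y) (cd y)); apply: (cvgM (F := nbhs y)).
    exact (cvgM (F := nbhs y) (@continuous_coord_sub x i y) (@continuous_coord_sub x j y)).
  exact: (cvg_comp _ _ (@continuous_sqn_sub x y) (inv_continuous q0)).
(* At the centre the quotient has no limit in general, but it is bounded by [1] while the factor
   [w0 - w1] tends to [0]. *)
rewrite subrr sqn0 w00 w10 subrr mulr0 mul0r; apply/cvgrPdist_le => e e0.
have := cd x; rewrite /continuous_at subrr sqn0 w00 w10 subrr mulr0.
move=> /cvgrPdist_le/(_ e e0); apply: filterS => z; rewrite !sub0r !normrN => ze.
rewrite normrM (le_trans _ ze)// ler_piMr// normrM normfV [X in _ / X]ger0_norm ?sqn_ge0//.
have [->|zx] := eqVneq z x; first by rewrite subrr sqn0 invr0 mulr0.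
by rewrite ler_pdivrMr ?sqn_gt0 ?subr_eq0// mul1r normrM sqn_normM.
Qed.

Lemma C2_radial x : [/\ C2 (fun z => G (sqn (z - x))),
  forall i, partial i (fun z => G (sqn (z - x))) x = 0 &
  forall i j, partial j (partial i (fun z => G (sqn (z - x)))) x = 0].
Proof.
have [|||||C p1 p2] := @C2_intro _ _ (fun z => G (sqn (z - x))) (D1 x) (D2 x).
- move=> i y; have dq := is_derive_sqn_sub x y i.
  apply: (is_derive_eq (is_derive_comp_scalar (f := fun z => sqn (z - x)) (dG _) dq)).
  by rewrite /D1; ring.
- exact: is_derive_D1.
- apply: continuous_comp_sqn => t; apply: differentiable_continuous.
  by apply/derivable1_diffP; have [] := dG t.
- move=> i y; apply: (cvgM (F := nbhs y)); last exact: continuous_coord_sub.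
  exact (cvgM (F := nbhs y) (cvg_cst _) (@continuous_comp_sqn _ x cw1 y)).
- exact: continuous_D2.
split => // [i|i j]; first by rewrite p1 /D1 subrr mxE mulr0.
by rewrite p2 /D2 subrr mxE !mul0r sqn0 w10 !mulr0 mul0r addr0.
Qed.

End C2Examples.

(** * Contact jets *)

Section Jets.
Variables (R : realType) (n N : nat).
Implicit Types (u psi : 'rV[R]_n -> 'rV[R]_N) (x y z h : 'rV[R]_n) (xi v w : 'rV[R]_N).
Implicit Types (P : 'M[R]_(N, n)) (X : 'I_N -> 'M[R]_n).

Lemma near_enormP x (Q : set 'rV[R]_n) : (\forall z \near x, Q z) <->
  exists2 d : R, 0 < d & forall z, enorm (z - x) < d -> Q z.
Proof.
split=> [/near_box[d d0 H]|[d d0 H]]; last by apply: filterS (near_enorm_lt x d0).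
by exists d => // z zd; apply: H => i; rewrite (le_lt_trans (coord_le_enorm _ _)).
Qed.

Lemma cvg_mx_coord (T : Type) (F : set_system T) (FF : Filter F) m k
    (f : T -> 'M[R]_(m, k)) (M : 'M[R]_(m, k)) :
  (forall i j, f t i j @[t --> F] --> M i j) -> f @ F --> M.
Proof.
move=> H A [Q MQ QA]; apply: (filterS (P := fun t => forall i j, Q i j (f t i j))).
  by move=> t; exact: QA.
by apply: filter_forall => i; apply: filter_forall => j; exact: (H i j _ (MQ i j)).
Qed.

Lemma jetrem_coord u x P X z a : jetrem u x P X z 0 a =
  u z 0 a - u x 0 a - quadratic_poly (row a P) (X a) (z - x).
Proof.
rewrite /jetrem /quadratic_poly !mxE opprD addrA; congr (_ - _ - _).
by apply: eq_bigr => k _; rewrite !mxE.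
Qed.

Lemma jetrem_self u x P X : jetrem u x P X x = 0.
Proof.
apply/rowP => a; rewrite jetrem_coord !subrr /quadratic_poly mul0mx mul0mx dotvC dotv0r.
by rewrite !mxE mulr0 addr0 subr0.
Qed.

Lemma gap0 xi : gap xi 0 = 0.
Proof. by rewrite /gap /enorm sqn0 sqrtr0 dotv0r addr0. Qed.

(** The crude constant [N + 1] stands in for [sqrt N] and avoids a root. *)
Lemma enorm_le_coord v (c : R) : 0 <= c -> (forall a, `|v 0 a| <= c) ->
  enorm v <= (N%:R + 1) * c.
Proof.
move=> c0 vc; apply: enorm_le; first by rewrite mulr_ge0// addr_ge0.
apply: (@le_trans _ _ (\sum_(a < N) c ^+ 2)).
  by apply: ler_sum => a _; rewrite -real_normK ?num_real// lerXn2r ?nnegrE.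
rewrite sumr_const card_ord -[c ^+ 2 *+ N]mulr_natl exprMn ler_wpM2r ?sqr_ge0//.
by have : 0 <= N%:R :> R by []; nra.
Qed.

Definition small_gap u x xi P X := forall e : R, 0 < e ->
  \forall z \near x, gap xi (jetrem u x P X z) <= e * sqn (z - x).

Lemma D2xi_small_gap (Omega : set 'rV[R]_n) u x xi P X : sqn xi = 1 ->
  D2xi Omega u x xi (P, X) -> (forall a, symmx (X a)) /\ small_gap u x xi P X.
Proof.
move=> xi1 [psi [C2psi [psix [/= PE [XE H]]]]]; split.
  by move=> a; rewrite XE; apply/matrixP => i j; rewrite !mxE partial_comm.
(* Half of [e] pays for [u - psi], half for the Taylor remainder of [psi], which [gap_triangle]
   counts twice and [enorm_le_coord] multiplies by [N + 1]. *)
move=> e e0; pose eta := e / 4 / (N%:R + 1).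
have N1 : 0 < N%:R + 1 :> R by rewrite ltr_wpDl.
have eta0 : 0 < eta by rewrite !divr_gt0.
have tay a := taylor2 x (C2psi a) eta0.
(* The choice [L = sqrt e] makes [L^2 |z - x|^2] twice the bound [e |z - x|^2 / 2] wanted for the
   gap of [u - psi]. *)
have sqe : 0 < Num.sqrt e by rewrite sqrtr_gt0.
apply: filterS2 (filter_forall _ tay) (H _ sqe) => z {tay H} tay [_].
rewrite (sqr_sqrtr (ltW e0)) => Hz.
have [->|zx] := eqVneq z x; first by rewrite jetrem_self gap0 subrr sqn0 mulr0.
have q0 : 0 < sqn (z - x) by rewrite sqn_gt0// subr_eq0.
have -> : jetrem u x P X z = (u z - psi z) + jetrem psi x P X z.
  by apply/rowP => a; rewrite [RHS]mxE !jetrem_coord psix !mxE !addrA subrK.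
have g1 : gap xi (u z - psi z) <= e * sqn (z - x) / 2.
  apply: gap_le_projperp => //; first by rewrite divr_gt0// mulr_gt0.
  by apply: le_trans Hz _; rewrite (_ : 2 * _ = e * sqn (z - x)) //; field.
have g2 : enorm (jetrem psi x P X z) <= (N%:R + 1) * (eta * sqn (z - x)).
  apply: enorm_le_coord => [|a]; first by rewrite mulr_ge0 ?sqn_ge0// ltW.
  have := tay a; rewrite jetrem_coord /compo; congr (`| _ - quadratic_poly _ _ _ | <= _).
    by apply/rowP => i; rewrite !mxE PE mxE.
  by rewrite XE.
apply: (le_trans (gap_triangle _ _ xi1)).
have -> : e * sqn (z - x) = e * sqn (z - x) / 2 +
    2 * ((N%:R + 1) * (eta * sqn (z - x))).
  by rewrite /eta; field; rewrite lt0r_neq0.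
by rewrite lerD// ler_pM2l.
Qed.

Lemma quadratic_form_le (A : 'M[R]_N) v (c : R) : (forall i j, `|A i j| <= c) ->
  (v *m A *m v^T) 0 0 <= N%:R * N%:R * c * sqn v.
Proof.
move=> Ac; rewrite mxE.
apply: (@le_trans _ _ (\sum_(j < N) \sum_(i < N) c * sqn v)).
  apply: ler_sum => j _; rewrite !mxE mulr_suml; apply: ler_sum => i _.
  rewrite (le_trans (ler_norm _))// !normrM mulrAC mulrC.
  by rewrite ler_pM ?mulr_ge0// sqn_normM.
rewrite !sumr_const !card_ord -[_ *+ N *+ N]mulr_natl -[_ * sqn v *+ N]mulr_natl.
by rewrite !mulrA.
Qed.

Lemma J2xi_small_gap u x xi P X : sqn xi = 1 -> J2xi u x xi (P, X) ->
  small_gap u x xi P X.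
Proof.
move=> xi1 [_ [T [_ [_ [T0 H]]]]] e e0 /=.
(* Entries of [T] at most [eta] bound its form by [N^2 eta]; [gap_le_vee] doubles this, and
   [2 N^2 eta <= e]. *)
pose eta := e / 2 / (N%:R * N%:R + 1).
have N1 : 0 < N%:R * N%:R + 1 :> R by rewrite ltr_wpDl ?mulr_ge0.
have eta0 : 0 < eta by rewrite !divr_gt0.
have nearT i j : \forall y \near (0 : 'rV[R]_n)^', `|T y i j| <= eta.
  have : T y i j @[y --> (0 : 'rV[R]_n)^'] --> (0 : 'M[R]_N) i j.
    exact: (cvg_comp _ _ T0 (@coord_continuous _ _ _ i j 0)).
  by rewrite mxE => /cvgrPdist_le/(_ _ eta0); apply: filterS => y; rewrite sub0r normrN.
have /near_enormP[d d0 Hd] : \forall y \near (0 : 'rV[R]_n), y != 0 ->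
    forall i j, `|T y i j| <= eta.
  exact (filter_forall (F := (0 : 'rV[R]_n)^') _ (fun i => filter_forall _ (nearT i))).
apply: filterS2 H (near_enorm_lt x d0) => z Hz zd.
have [->|zx] := eqVneq z x; first by rewrite jetrem_self gap0 subrr sqn0 mulr0.
have zx0 : z - x != 0 by rewrite subr_eq0.
have {}Hd := Hd (z - x); rewrite subr0 in Hd.
have := @gap_le_vee _ _ xi (jetrem u x P X z) (sqn (z - x) * (N%:R * N%:R * eta)) xi1.
have t0 : 0 <= sqn (z - x) * (N%:R * N%:R * eta).
  by rewrite mulr_ge0 ?sqn_ge0// mulr_ge0 ?mulr_ge0// ltW.
move=> /(_ t0) gv; apply: le_trans (gv _) _ => [v|].
  rewrite -vee_form (le_trans (Hz zx v))// -scalemxAr -scalemxAl mxE -mulrA.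
  by rewrite ler_wpM2l ?sqn_ge0// quadratic_form_le// => i j; exact: Hd.
rewrite mulrCA [leRHS]mulrC ler_wpM2l ?sqn_ge0//.
rewrite /eta !mulrA ler_pdivrMr//; have : 0 <= N%:R * N%:R :> R by rewrite mulr_ge0.
nra.
Qed.

Lemma small_gap_D2xi (Omega : set 'rV[R]_n) u x xi P X :
  open Omega -> Omega x -> sqn xi = 1 -> (forall a, symmx (X a)) ->
  small_gap u x xi P X -> D2xi Omega u x xi (P, X).
Proof.
move=> oO Ox xi1 sX K.
have /choice[d Hd] : forall e : R, exists d, 0 < e -> 0 < d /\
    forall z, enorm (z - x) < d -> gap xi (jetrem u x P X z) <= e * sqn (z - x).
  move=> e; have [e0|_] := ltP 0 e; last by exists 0.
  by have /near_enormP[d d0 H] := K e e0; exists d.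
(* The modulus will be evaluated at [|z - x|^2], so the radii enter squared. *)
have d20 e : 0 < e -> 0 < d e ^+ 2 by move=> /Hd[d0 _]; rewrite exprn_gt0.
have [G [w1 [w0 [[G0 [w10 w00]] [cw0 cw1] dG dw1 Gge]]]] := modulus_primitives d20.
have gapG z : enorm (z - x) < d 1 -> gap xi (jetrem u x P X z) <= 4 * G (sqn (z - x)).
  move=> zd; have [->|zx] := eqVneq z x.
    by rewrite jetrem_self gap0 subrr sqn0 G0 mulr0.
  have q0 : 0 < sqn (z - x) by rewrite sqn_gt0// subr_eq0.
  (* The quotient [c = gap / |z - x|^2] lies below every [e + |z - x|^2 / (d e)^2]: inside radius
     [d e] it is at most [e]; outside, the second term is at least [1], and [c <= 1] because
     [|z - x| < d 1]. *)
  have := Gge (sqn (z - x)) (gap xi (jetrem u x P X z) / sqn (z - x)) q0.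
  rewrite divfK ?gt_eqF// ler_pdivrMr// (mulrC _ 4); apply => e e0.
  have [de0 He] := Hd e e0; have [ze|ez] := ltP (enorm (z - x)) (d e).
    rewrite (le_trans (y := e))// ?ler_pdivrMr ?He// lerDl divr_ge0 ?sqn_ge0// ltW//.
    exact: d20.
  rewrite (le_trans (y := 1))//.
    by rewrite ler_pdivrMr// (Hd 1 ltr01).2.
  apply: ler_wpDl; first exact: ltW.
  rewrite ler_pdivlMr ?d20// mul1r -enorm_sqr.
  by rewrite lerXn2r ?nnegrE ?enorm_ge0// ltW.
have [CG pG ppG] := C2_radial cw0 cw1 w00 w10 dG dw1 x.
pose psi z := u x + ((z - x) *m P^T + 2^-1 *: \row_a ((z - x) *m X a *m (z - x)^T) 0 0)
  + 4 * G (sqn (z - x)) *: xi.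
have psiE a : compo a psi = fun z => u x 0 a + quadratic_poly (row a P) (X a) (z - x)
    + 4 * xi 0 a * G (sqn (z - x)).
  apply/funext => z; rewrite /compo /psi /quadratic_poly !mxE.
  rewrite -[X in _ = _ + X]mulrAC; congr (_ + (_ + _) + _).
  by apply: eq_bigr => k _; rewrite !mxE.
have C2psi a : [/\ C2 (compo a psi), forall i, partial i (compo a psi) x = P a i &
    forall i j, partial j (partial i (compo a psi)) x = X a i j].
  have [CQ pQ ppQ] := C2_quadratic_poly (row a P) x (sX a).
  have [C p1 p2] := C2_affine_comb (4 * xi 0 a) (u x 0 a) CQ CG.
  rewrite psiE; split; first exact: C.
    by move=> i; rewrite p1 pQ pG mulr0 addr0 mxE.
  by move=> i j; rewrite p2 ppQ ppG mulr0 addr0.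
have upsi z : u z - psi z = jetrem u x P X z - (4 * G (sqn (z - x))) *: xi.
  by rewrite /psi /jetrem !opprD !addrA.
exists psi; split; first by move=> a; have [] := C2psi a.
split.
  by apply/eqP; rewrite eq_sym -subr_eq0 upsi jetrem_self subrr sqn0 G0 mulr0 scale0r subr0.
split; first by apply/matrixP => a i; rewrite !mxE; have [_ ->] := C2psi a.
split.
  by apply/funext => a; apply/matrixP => i j; rewrite !mxE; have [_ _ ->] := C2psi a.
move=> L L0; have L20 : 0 < L ^+ 2 / 2 by rewrite divr_gt0// exprn_gt0.
have near1 := near_enorm_lt x (Hd 1 ltr01).1.
have nearO : \forall z \near x, Omega z by exact: open_nbhs_nbhs.
apply: filterS3 nearO near1 (K _ L20) => z Oz /gapG gz gL; split => //.
rewrite upsi.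
(* Here [t] is the gap itself, small relative to [|z - x|^2] for this [L], while [s = 4 G] does not
   depend on [L]. *)
apply: (le_trans (projperp_le_gap xi1 (gap_ge0 _ xi1) gz (lexx _))).
rewrite ler_wpM2r//; last by move: gL; nra.
(* The remaining factor is nonnegative: [s >= |w| + xi.w] gives [s - xi.w >= |w|]. *)
move: gz; rewrite /gap; set s := 4 * _; set w := jetrem _ _ _ _ _.
have := dotv_linr xi 1 (- s) w xi; rewrite scale1r scaleNr mul1r -sqnE xi1 mulr1 => ->.
by have := enorm_ge0 w; lra.
Qed.

Lemma continuous_gap xi : continuous (@gap R N xi).
Proof.
move=> w; apply: (cvgD (F := nbhs w)); first exact: continuous_enorm.
have cS : continuous (fun v => \sum_i xi 0 i * v 0 i).
  apply: continuous_sum_ord => i v.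
  exact (cvgM (F := nbhs v) (cvg_cst _) (@coord_continuous _ _ _ 0 i v)).
exact: cS.
Qed.

Lemma jetrem_continuous_at u x P X z : {for z, continuous u} ->
  {for z, continuous (jetrem u x P X)}.
Proof.
move=> cu; apply: (cvg_mx_coord (F := nbhs z)) => i a; rewrite (ord1 i) jetrem_coord.
have -> : (fun y => jetrem u x P X y 0 a) =
    (fun y => u y 0 a - u x 0 a - quadratic_poly (row a P) (X a) (y - x)).
  by apply/funext => y; exact: jetrem_coord.
apply: (cvgB (F := nbhs z)); last exact: continuous_quadratic_poly.
apply: (cvgB (F := nbhs z)); last exact: cvg_cst.
exact: (cvg_comp _ _ cu (@coord_continuous _ _ _ 0 a (u z))).
Qed.

(* Composing with the radial retraction [rho] onto a closed ball around [x] contained in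
   [Omega] makes the eigenvalue quotient continuous on the whole punctured space. *)
Lemma small_gap_J2xi (Omega : set 'rV[R]_n) u x xi P X :
  open Omega -> {within Omega, continuous u} -> Omega x -> sqn xi = 1 ->
  (forall a, symmx (X a)) -> small_gap u x xi P X -> J2xi u x xi (P, X).
Proof.
move=> oO cu Ox xi1 sX K; split => //=.
have /near_enormP[d d0 dO] : \forall z \near x, Omega z by exact: open_nbhs_nbhs.
pose r := d / 2; have r0 : 0 < r by rewrite divr_gt0.
have m0 h : 0 < Num.max r (enorm h) by rewrite lt_max r0.
pose rho h := (r / Num.max r (enorm h)) *: h.
have rho0 h : h != 0 -> rho h != 0.
  by move=> h0; rewrite scaler_eq0 negb_or h0 andbT gt_eqF// divr_gt0.
have rho_id h : enorm h < r -> rho h = h.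
  by move=> hr; rewrite /rho max_l ?ltW// divff ?gt_eqF// scale1r.
have rhoO h : Omega (x + rho h).
  apply: dO; rewrite addrAC subrr add0r; apply: (@le_lt_trans _ _ r).
    apply: enorm_le; first exact: ltW.
    rewrite sqnZ exprMn -mulrA ler_piMr ?sqr_ge0// exprVn mulrC ler_pdivrMr ?exprn_gt0//.
    by rewrite mul1r -enorm_sqr lerXn2r ?nnegrE ?enorm_ge0 ?(ltW (m0 h))// le_max lexx orbT.
  by rewrite /r; lra.
have crho : continuous rho.
  move=> h; have cr : {for h, continuous (fun _ : 'rV[R]_n => r)} by exact: cst_continuous.
  have cm : Num.max r (enorm y) @[y --> h] --> Num.max r (enorm h).
    exact (continuous_max cr (@continuous_enorm R n h)).
  apply: (cvgZ (F := nbhs h)); last exact: cvg_id.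
  apply: (cvgM (F := nbhs h)); first exact: cvg_cst.
  exact: (cvg_comp _ _ cm (inv_continuous (lt0r_neq0 (m0 h)))).
(* By [vee_le_gap], half the gap times the identity dominates [vee xi w]; hence [g] times the
   identity is a candidate for [T], as far as [x + h] stays in [Omega]. *)
pose g h := gap xi (jetrem u x P X (x + h)) / sqn h / 2.
have cg h : h != 0 -> {for h, continuous (g \o rho)}.
  move=> h0; have cu' : {for x + rho h, continuous u}.
    by move: cu; rewrite continuous_open_subspace// => /(_ (x + rho h)); apply; rewrite inE.
  have cx : x + rho y @[y --> h] --> x + rho h.
    exact (cvgD (F := nbhs h) (cvg_cst x) (crho h)).
  apply: (cvgM (F := nbhs h)); last exact: cvg_cst.
  apply: (cvgM (F := nbhs h)).
    have cj := cvg_comp _ _ cx (@jetrem_continuous_at u x P X _ cu').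
    exact: (cvg_comp _ _ cj (@continuous_gap xi _)).
  have q0 : sqn (rho h) != 0 by rewrite gt_eqF// sqn_gt0// rho0.
  have cq := cvg_comp _ _ (crho h) (@continuous_sqn R n (rho h)).
  exact: (cvg_comp _ _ cq (inv_continuous q0)).
have g_small e : 0 < e -> \forall z \near x, g (z - x) <= e.
  move=> e0; have e2 : 0 < 2 * e by rewrite mulr_gt0.
  apply: filterS (K _ e2) => z; rewrite /g (addrC x) subrK => gz.
  have [->|zx] := eqVneq z x; first by rewrite jetrem_self gap0 !mul0r ltW.
  by rewrite ler_pdivrMr// ler_pdivrMr ?sqn_gt0 ?subr_eq0// (mulrC e).
have g_ge0 h : 0 <= g h by rewrite !divr_ge0 ?sqn_ge0 ?gap_ge0.
exists (fun h => (g (rho h))%:M); split.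
  apply: continuous_in_subspaceT => h; rewrite inE /= => h0.
  apply: (cvg_mx_coord (F := nbhs h)) => i j; rewrite mxE.
  under eq_fun do rewrite mxE.
  by apply: (cvgMn (F := nbhs h)); exact: cg.
split; first by move=> h _; rewrite /symmx tr_scalar_mx.
split.
  apply: cvg_mx_coord => i j; rewrite mxE; apply/cvgrPdist_le => e e0.
  have /near_enormP[c c0 Hc] := g_small e e0.
  have cr0 : 0 < Num.min c r by rewrite lt_min c0.
  (* Within radius [r] the retraction is the identity, so the limit at [0] is that of [g]. *)
  apply: cvg_within; apply: filterS (near_enorm_lt 0 cr0) => h.
  rewrite subr0 lt_min => /andP[hc hr]; rewrite sub0r normrN mxE rho_id//.
  rewrite normrMn ger0_norm ?g_ge0//; case: (i == j); last by rewrite mulr0n ltW.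
  by rewrite mulr1n; have := Hc (x + h); rewrite (addrAC x) subrr add0r; exact.
apply: filterS (near_enorm_lt x r0) => z zr zx v; rewrite rho_id//.
rewrite vee_form scale_scalar_mx mul_mx_scalar -scalemxAl mxE.
have -> : (v *m v^T) 0 0 = sqn v.
  by rewrite mxE sqnE; apply: eq_bigr => k _; rewrite !mxE.
rewrite /g (addrC x) subrK mulrA mulrCA divff ?mulr1; last first.
  by rewrite gt_eqF// sqn_gt0// subr_eq0.
by have := vee_le_gap v (jetrem u x P X z) xi1; lra.
Qed.

End Jets.

Unset Implicit Arguments.

Theorem theorem35 (R : realType) (n N : nat) (Omega : set 'rV[R]_n)
  (u : 'rV[R]_n -> 'rV[R]_N) (x : 'rV[R]_n) (xi : 'rV[R]_N) :
  open Omega -> {within Omega, continuous u} -> Omega x -> sqn xi = 1 ->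
  D2xi Omega u x xi = J2xi u x xi.
Proof.
move=> oO cu Ox xi1; apply/seteqP; split=> -[P X].
  by move=> /(D2xi_small_gap xi1)[sX K]; exact: (small_gap_J2xi oO cu Ox).
move=> J; apply: (small_gap_D2xi oO Ox xi1 J.1).
exact: J2xi_small_gap J.
Qed.
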